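(* Let $G$ be a finite group acting on a sandpile graph $\Gamma=(V,E,\mathrm{wt},s)$ with non-sink vertex set $\widetilde V$, let $\mathcal{O}=\{Gv:v\in\widetilde V\}$ be the set of orbits of non-sink vertices, and let $\widetilde\Delta^G\colon\mathbb{Z}\mathcal{O}\to\mathbb{Z}\mathcal{O}$ be the symmetrized reduced Laplacian. Let $r\colon\mathbb{Z}\widetilde V/\mathrm{image}(\widetilde\Delta)\to\mathcal{S}(\Gamma)$ denote the inverse of the isomorphism $\mathcal{S}(\Gamma)\to\mathbb{Z}\widetilde V/\mathrm{image}(\widetilde\Delta)$, $c\mapsto c$. Then there is an isomorphism of groups $$\phi\colon\mathbb{Z}\mathcal{O}/\mathrm{image}(\widetilde\Delta^G)\to\mathcal{S}(\Gamma)^G$$ determined by $Gv\mapsto r\left(\sum_{w\in Gv}w\right)$ for $v\in\widetilde V$.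
   Context: Sandpile graph: $\Gamma=(V,E,\mathrm{wt},s)$ is a finite directed graph with edge-weight function $\mathrm{wt}\colon V\times V\to\mathbb{N}=\{0,1,2,\dots\}$, $\mathrm{wt}(v,w)>0$ iff $(v,w)\in E$, and a vertex $s$ (the sink) such that every vertex has a directed path to $s$. Let $\widetilde V=V\setminus\{s\}$ and $\mathrm{outdeg}(v)=\sum_{w\in V}\mathrm{wt}(v,w)$. Configurations: a configuration is an element $c=\sum_{v\in\widetilde V}c_v v\in\mathbb{N}\widetilde V$. A vertex $v\in\widetilde V$ is unstable in $c$ if $c_v\ge\mathrm{outdeg}(v)$; firing it replaces $c$ by $c-\mathrm{outdeg}(v)v+\sum_{w\in\widetilde V}\mathrm{wt}(v,w)w$. Repeatedly firing unstable vertices leads in finitely many steps to a stable configuration (no unstable vertices) $c^\circ$, independent of the choices made. A configuration $c$ is recurrent if it is stable and for every configuration $a$ there is a configuration $b$ with $(a+b)^\circ=c$. The recurrent configurations form a group under $(a,b)\mapsto(a+b)^\circ$, the sandpile group $\mathcal{S}(\Gamma)$. Reduced Laplacian: $\widetilde\Delta\colon\mathbb{Z}\widetilde V\to\mathbb{Z}\widetilde V$, $\widetilde\Delta(v)=\mathrm{outdeg}(v)v-\sum_{w\in\widetilde V}\mathrm{wt}(v,w)w$. It is well known that sending a recurrent configuration to its class gives an isomorphism $\mathcal{S}(\Gamma)\to\mathbb{Z}\widetilde V/\mathrm{image}(\widetilde\Delta)$. Action: an action of $G$ on $\Gamma$ is an action of $G$ on the set $V$ with $gs=s$ for all $g\in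 G$ and such that $(v,w)\in E$ implies $(gv,gw)\in E$ with both edges having the same weight. It extends linearly to $\mathbb{Z}\widetilde V$ and to configurations. $\mathcal{S}(\Gamma)^G$ denotes the subgroup of $\mathcal{S}(\Gamma)$ of recurrent configurations $c$ with $gc=c$ for all $g\in G$. Symmetrized reduced Laplacian: the $\mathbb{Z}$-linear map $\widetilde\Delta^G\colon\mathbb{Z}\mathcal{O}\to\mathbb{Z}\mathcal{O}$ such that for all $v,w\in\widetilde V$ the $Gw$-th component of $\widetilde\Delta^G(Gv)$ is the $w$-th component of $\sum_{u\in Gv}\widetilde\Delta(u)$ (this does not depend on the choice of representative $w$ of its orbit). *)

(* Defs.v *)
From HB Require Import structures.
From Stdlib Require Import Relation_Operators.
From mathcomp Require Import all_boot all_order all_fingroup all_algebra.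
From mathcomp Require Import boolp zify.

Set Implicit Arguments.
Unset Strict Implicit.
Unset Printing Implicit Defensive.

Import GRing.Theory.
Local Open Scope ring_scope.

Section Cokernel.
Variables (U V : zmodType) (f : {additive U -> V}).

Definition zimage : {pred V} := [pred y | `[< exists x, y = f x >]].

Lemma zimageP y : reflect (exists x, y = f x) (y \in zimage).
Proof. exact: asboolP. Qed.

Fact zimage_closed : zmod_closed zimage.
Proof.
split=> [|_ _ /zimageP[x ->] /zimageP[y ->]]; apply/zimageP.
  by exists 0; rewrite raddf0.
by exists (x - y); rewrite raddfB.
Qed.
HB.instance Definition _ := GRing.isZmodClosed.Build V zimage zimage_closed.

Definition coker : zmodType := Quotient.quot (zimage : zmodClosed V).
Definition coker_pi : V -> coker := \pi_coker%qT.

Fact coker_pi_is_zmod_morphism : zmod_morphism coker_pi.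
Proof. exact: (raddfB (\pi_(Quotient.quot (zimage : zmodClosed V))%qT)). Qed.
HB.instance Definition _ :=
  GRing.isZmodMorphism.Build V coker coker_pi coker_pi_is_zmod_morphism.

Lemma coker_pi_eq x y : coker_pi x = coker_pi y <-> exists u, x - y = f u.
Proof.
split=> [/eqP|xy]; last apply/eqP.
  by rewrite -Quotient.idealrBE => /zimageP.
by rewrite -Quotient.idealrBE; apply/zimageP.
Qed.

Lemma coker_piP (q : coker) : exists x, coker_pi x = q.
Proof. by exists (generic_quotient.repr q); rewrite /coker_pi reprK. Qed.
End Cokernel.

(* The edge set is recovered from the weights: (v, w) is an edge iff
   [0 < wt v w]. *)
Record sandpile_graph := SandpileGraph {
  vertex : finType;
  wt : vertex -> vertex -> nat;
  sink : vertex;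
  sinkP : forall v, connect (fun x y => 0 < wt x y)%N v sink }.

Definition edge (Gam : sandpile_graph) : rel (vertex Gam) :=
  fun v w => (0 < wt v w)%N.
Definition outdeg (Gam : sandpile_graph) (v : vertex Gam) : nat :=
  (\sum_w wt v w)%N.
Definition nonsink (Gam : sandpile_graph) := {v : vertex Gam | v != sink Gam}.
HB.instance Definition _ Gam := Finite.on (nonsink Gam).

Definition config (Gam : sandpile_graph) := {ffun nonsink Gam -> nat}.
HB.instance Definition _ Gam := GRing.Nmodule.on (config Gam).

Section Potential.
Variable Gam : sandpile_graph.

(* With [h] as weights, every firing lowers the total weight of the grains. *)
Lemma exists_potential : exists h : vertex Gam -> nat,
  forall v : vertex Gam, v != sink Gam ->
    (\sum_w wt v w * h w < outdeg v * h v)%N.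
Proof.
pose P (v : vertex Gam) n := `[< exists2 p, path (@edge Gam) v p /\
      last v p = sink Gam
                           & size p = n >].
have exP (v : vertex Gam) : exists n, P v n.
  have /connectP[p pp pl] := sinkP v.
  by exists (size p); apply/asboolP; exists p.
pose d v := ex_minn (exP v).
have dP v : v != sink Gam -> exists2 w, edge v w & (d w < d v)%N.
  move=> vs; rewrite {2}/d; case: ex_minnP => n /asboolP[[|w p]].
    by case=> _ /= vs'; rewrite vs' eqxx in vs.
  case=> /= /andP[vw pp] pl <- _; exists w => //.
  rewrite /d ltnS; case: ex_minnP => m _; apply; apply/asboolP; by exists p.
pose D := (\max_v d v)%N; pose N := (\max_(v : vertex Gam) outdeg v).+1.
pose g v := (N ^ (D - d v))%N.
have dD v : (d v <= D)%N by rewrite /D; apply: leq_bigmax.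
have gN v : (g v <= N ^ D)%N by rewrite leq_pexp2l ?leq_subr.
exists (fun v => N ^ D - g v)%N => v vs.
have E : (\sum_w wt v w * (N ^ D - g w) + \sum_w wt v w * g w
          = outdeg v * N ^ D)%N.
  rewrite -big_split /outdeg big_distrl /=; apply: eq_bigr => w _.
  by rewrite -mulnDr subnK.
have {dP}[w vw dw] := dP v vs.
have gw : (N * g v <= g w)%N.
  by rewrite /g -expnS leq_pexp2l //; have := dD v; lia.
have : (N * g v <= \sum_w wt v w * g w)%N.
  rewrite (bigD1 w) //=; apply: (leq_trans gw).
  by apply: (leq_trans _ (leq_addr _ _)); apply: leq_pmull.
have g0 : (0 < g v)%N by rewrite expn_gt0.
have oN : (outdeg v * g v < N * g v)%N.
  by rewrite ltn_pmul2r // ltnS; apply: (leq_bigmax v).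
have := gN v; rewrite mulnBr => _; lia.
Qed.
End Potential.

Section Firing.
Variable Gam : sandpile_graph.
Local Notation nonsink := (nonsink Gam).
Local Notation config := (config Gam).
Implicit Type c : config.

Definition unstable c (v : nonsink) : bool := (outdeg (val v) <= c v)%N.
Definition stable c : bool := [forall v, ~~ unstable c v].

(* The truncated subtraction is exact when [v] is unstable in [c], the only
   case in which [fire] is used. *)
Definition fire (v : nonsink) c : config :=
  [ffun w => (c w - (if w == v then outdeg (val v) else 0)
              + wt (val v) (val w))%N].

Definition fires c c' : Prop := exists2 v, unstable c v & c' = fire v c.
Definition stabilizes c c' : Prop :=
  clos_refl_trans_1n config fires c c' /\ stable c'.

Local Notation steps := (clos_refl_trans_1n config fires).

Lemma steps_trans c1 c2 c3 : steps c1 c2 -> steps c2 c3 -> steps c1 c3.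
Proof.
by elim=> [//|x y z xy _ IH] /IH; apply: Relation_Operators.rt1n_trans.
Qed.

Lemma configD c c' w : (c + c') w = (c w + c' w)%N.
Proof. by rewrite ffunE. Qed.

Lemma steps_add a c c' : steps c c' -> steps (a + c) (a + c').
Proof.
elim=> [x|x y z [v xv ->] _ IH]; first exact: rt1n_refl.
apply: Relation_Operators.rt1n_trans IH; exists v.
  by rewrite /unstable configD (leq_trans xv) ?leq_addl.
move: xv; rewrite /unstable => xv.
by apply/ffunP=> w; rewrite !(configD, ffunE); case: eqP => [->|_]; lia.
Qed.

Lemma sum_nonsink (F : vertex Gam -> nat) :
  (\sum_(w : nonsink) F (val w) <= \sum_w F w)%N.
Proof.
rewrite [leqRHS](bigID (fun w : vertex Gam => w != sink Gam)) /=.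
rewrite (reindex_omap (val : nonsink -> _) insub) => [|w ws]; last first.
  by rewrite insubT.
apply: leq_trans (leq_addr _ _); rewrite big_mkcond [leqRHS]big_mkcond.
by apply: leq_sum => w _ /=; rewrite (valP w) valK eqxx.
Qed.

Lemma exists_rank : exists pot : config -> nat,
  forall c c', fires c c' -> (pot c' < pot c)%N.
Proof.
have [h hP] := exists_potential Gam.
exists (fun c => \sum_w c w * h (val w))%N => c _ [v cv ->].
have hv := hP _ (valP v).
have /= hA := sum_nonsink (fun w => wt (val v) w * h w)%N.
have /= -> : (\sum_w fire v c w * h (val w) =
   \sum_w (c w - (if w == v then outdeg (val v) else 0)) * h (val w)
   + \sum_(w : nonsink) wt (val v) (val w) * h (val w))%N.
  by rewrite -big_split /=; apply: eq_bigr => w _; rewrite ffunE mulnDl.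
rewrite (bigD1 v) //= eqxx [X in (_ < X)%N](bigD1 v) //=.
rewrite (eq_bigr (fun w => c w * h (val w)))%N; last first.
  by move=> w /negPf->; rewrite subn0.
have := leq_mul cv (leqnn (h (val v))); rewrite mulnBl /= in hv hA *; lia.
Qed.

Lemma stabilizes_exists c : exists c', stabilizes c c'.
Proof.
have [pot potP] := exists_rank.
have [n] := ubnP (pot c); elim: n c => // n IH c; rewrite ltnS => cn.
have [cs|] := boolP (stable c); first by exists c; split=> //; apply: rt1n_refl.
rewrite negb_forall => /existsP[v]; rewrite negbK => cv.
have cf : fires c (fire v c) by exists v.
have [c' [cc' c's]] := IH _ (leq_trans (potP _ _ cf) cn).
by exists c'; split=> //; apply: Relation_Operators.rt1n_trans cc'.
Qed.

Lemma fire_diamond v w c : v != w -> unstable c v -> unstable c w ->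
  unstable (fire v c) w /\ fire w (fire v c) = fire v (fire w c).
Proof.
rewrite /unstable => vw cv cw; split.
  by rewrite ffunE eq_sym (negPf vw) subn0 (leq_trans cw) ?leq_addr.
apply/ffunP=> x; rewrite !ffunE.
have [->|xw] := eqVneq x w; last have [->|xv] := eqVneq x v.
- by rewrite eq_sym (negPf vw); lia.
- lia.
- lia.
Qed.

Lemma stepsV c c' : steps c c' -> c = c' \/ exists2 d, fires c d & steps d c'.
Proof. by case=> [|d c'' cd dc]; [left | right; exists d]. Qed.

Lemma stabilizes_step c d c' : fires c d -> stabilizes c c' -> stabilizes d c'.
Proof.
have [pot potP] := exists_rank.
have [n] := ubnP (pot c); elim: n c d => // n IH c d; rewrite ltnS => cn.
case=> v cv -> [/stepsV[cc' /forallP/(_ v)|]]; first by rewrite -cc' cv.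
case=> _ [w cw ->] st c's.
have [->|vw] := eqVneq v w; first by split.
have [fvw fE] := fire_diamond vw cv cw.
have wv : w != v by rewrite eq_sym.
have [fwv _] := fire_diamond wv cw cv.
have cfw : fires c (fire w c) by exists w.
have fwP : fires (fire w c) (fire v (fire w c)) by exists v.
have [st' _] := IH _ _ (leq_trans (potP _ _ cfw) cn) fwP (conj st c's).
split=> //; apply: Relation_Operators.rt1n_trans st'; by exists w.
Qed.

Lemma stabilizes_steps c d c' : steps c d -> stabilizes c c' -> stabilizes d c'.
Proof. by elim=> // x y z xy _ IH /(stabilizes_step xy). Qed.

Lemma stabilizes_unique c c1 c2 : stabilizes c c1 -> stabilizes c c2 -> c1 = c2.
Proof.
move=> [cc1 c1s] /(stabilizes_steps cc1) [c12 _].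
case/stepsV: c12 c1s => // -[_ [v cv _] _] /forallP/(_ v); by rewrite cv.
Qed.

Definition stabilization c : config := projT1 (cid (stabilizes_exists c)).

Lemma stabilizationP c : stabilizes c (stabilization c).
Proof. exact: projT2 (cid (stabilizes_exists c)). Qed.

Lemma stabilizationE c c' : stabilizes c c' <-> stabilization c = c'.
Proof.
split=> [|<-]; last exact: stabilizationP.
exact: stabilizes_unique (stabilizationP c).
Qed.

Lemma stabilization_steps c d :
  steps c d -> stabilization c = stabilization d.
Proof.
by move=> cd; apply/esym/stabilizationE/(stabilizes_steps cd)/stabilizationP.
Qed.

Lemma stabilizationDr a c :
  stabilization (a + stabilization c) = stabilization (a + c).
Proof.
by apply/esym/stabilization_steps/steps_add; case: (stabilizationP c).
Qed.

Lemma stabilizationDl a c :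
  stabilization (stabilization a + c) = stabilization (a + c).
Proof. by rewrite addrC stabilizationDr addrC. Qed.

Definition recurrent c : Prop :=
  stable c /\ forall a, exists b, stabilization (a + b) = c.

Lemma recurrentD c a : recurrent c -> recurrent (stabilization (c + a)).
Proof.
case=> _ cP; split=> [|b]; first by case: (stabilizationP (c + a)).
by have [d <-] := cP b; exists (d + a); rewrite stabilizationDl addrA.
Qed.

Definition max_config : config := [ffun v => outdeg (val v)].

Lemma recurrent_max b : recurrent (stabilization (max_config + b)).
Proof.
split=> [|a]; first by case: (stabilizationP (max_config + b)).
pose d : config := [ffun v => max_config v - stabilization a v]%N.
exists (d + b); rewrite -stabilizationDl addrA; congr (stabilization (_ + b)).
apply/ffunP=> v; rewrite configD !ffunE subnKC //.
case: (stabilizationP a) => _ /forallP/(_ v).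
by rewrite /unstable -ltnNge => /ltnW.
Qed.
End Firing.

Section Laplacian.
Variable Gam : sandpile_graph.
Local Notation nonsink := (nonsink Gam).
Local Notation config := (config Gam).
Local Notation zconfig := {ffun nonsink -> int}.
Local Notation steps := (clos_refl_trans_1n config (@fires Gam)).
Implicit Type c : config.

Definition zvec (I : finType) (i : I) : {ffun I -> int} :=
  [ffun j => (j == i)%:R].

Definition laplacian1 (v : nonsink) : zconfig :=
  zvec v *+ outdeg (val v) - \sum_w zvec w *+ wt (val v) (val w).

Definition laplacian (x : zconfig) : zconfig := \sum_v laplacian1 v *~ x v.

Fact laplacian_is_zmod_morphism : zmod_morphism laplacian.
Proof.
move=> x y; rewrite /laplacian -sumrB; apply: eq_bigr => v _.
by rewrite !ffunE mulrzBr.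
Qed.
HB.instance Definition _ :=
  GRing.isZmodMorphism.Build zconfig zconfig laplacian
    laplacian_is_zmod_morphism.

Lemma zvecE (I : finType) (i j : I) : zvec i j = (j == i)%:R.
Proof. by rewrite ffunE. Qed.

Lemma laplacian_zvec v : laplacian (zvec v) = laplacian1 v.
Proof.
rewrite /laplacian (bigD1 v) //= big1 => [|w /negPf wv].
  by rewrite addr0 zvecE eqxx mulr1z.
by rewrite zvecE wv mulr0z.
Qed.

Lemma laplacian1E v w : laplacian1 v w =
  (if w == v then (outdeg (val v))%:Z else 0) - (wt (val v) (val w))%:Z.
Proof.
rewrite !ffunE sum_ffunE (bigD1 w) //= big1 => [|u /negPf uw]; last first.
  by rewrite ffunMnE zvecE eq_sym uw mul0rn.
rewrite addr0 !ffunMnE !zvecE eqxx.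
by case: eqP => _; rewrite ?mul0rn ?natz //.
Qed.

Definition int_config (c : config) : zconfig := [ffun v => (c v)%:Z].

Lemma int_configD a b : int_config (a + b) = int_config a + int_config b.
Proof. by apply/ffunP=> v; rewrite !ffunE. Qed.

Lemma int_config_inj : injective int_config.
Proof.
by move=> a b /ffunP ab; apply/ffunP=> v; have := ab v; rewrite !ffunE => -[].
Qed.

Lemma int_config_fire v c : unstable c v ->
  int_config (fire v c) = int_config c - laplacian1 v.
Proof.
rewrite /unstable => cv; apply/ffunP=> w; rewrite !(laplacian1E, ffunE).
case: eqP => [->|_].
  by move: (c v) (outdeg _) (wt _ _) cv => x y z; lia.
by move: (c w) (wt _ _) => x y; lia.
Qed.

Lemma int_config_steps c c' : steps c c' ->
  exists x, int_config c - int_config c' = laplacian x.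
Proof.
elim=> [x|x y z [v xv ->] _ [u IH]]; first by exists 0; rewrite raddf0 subrr.
exists (zvec v + u); rewrite raddfD /= laplacian_zvec -IH.
by rewrite int_config_fire // [X in _ = _ + X]addrAC [RHS]addrC subrK.
Qed.

Definition config_class (c : config) : coker laplacian :=
  coker_pi laplacian (int_config c).

Lemma config_classD a b :
  config_class (a + b) = config_class a + config_class b.
Proof. by rewrite /config_class int_configD raddfD. Qed.

Lemma config_class_stabilization c :
  config_class (stabilization c) = config_class c.
Proof.
apply/esym/coker_pi_eq; apply: int_config_steps; exact: (stabilizationP c).1.
Qed.

Lemma fire_script (f : config) c d :
  (forall v, \sum_w f w * outdeg (val v) <= c v)%N ->
  int_config c - laplacian (int_config f) = int_config d -> steps c d.
Proof.
have [n] := ubnP (\sum_w f w)%N; elim: n f c => // n IH f c; rewrite ltnS => fn.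
have [/forallP f0|] := boolP [forall v, f v == 0%N].
  have -> : int_config f = 0.
    by apply/ffunP=> v; rewrite !ffunE; have /eqP-> := f0 v.
  by rewrite raddf0 subr0 => _ /int_config_inj ->; apply: rt1n_refl.
rewrite negb_forall => /existsP[v fv] cP E.
pose f' : config := [ffun w => f w - (w == v)]%N.
have fE : (\sum_w f w = (\sum_w f' w).+1)%N.
  rewrite (bigD1 v) //= [in RHS](bigD1 v) //= ffunE eqxx.
  rewrite (eq_bigr f') => [|w /negPf wv]; last by rewrite ffunE wv subn0.
  by rewrite -addSn subn1 prednK ?lt0n.
have cv w : ((\sum_w f' w) * outdeg (val w) + outdeg (val w) <= c w)%N.
  by have := cP w; rewrite -big_distrl /= fE mulSn addnC.
have ucv : unstable c v := leq_trans (leq_addl _ _) (cv v).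
apply: (Relation_Operators.rt1n_trans _ _ _ (fire v c)); first by exists v.
apply: (IH f') => [|w|]; first by rewrite fE in fn.
  rewrite -big_distrl ffunE /=; have := cv w.
  move: (_ * _)%N (c w) (wt _ _) => x y z.
  by case: eqP => [->|_]; move: (outdeg _) => t; lia.
rewrite int_config_fire // -E -laplacian_zvec -addrA -opprD.
rewrite -raddfD; congr (_ - laplacian _); apply/ffunP=> w; rewrite !ffunE.
by case: eqP => [->|_]; [move: (f v) fv | move: (f w)] => x; lia.
Qed.

Lemma exists_large (k : nat) : exists2 e : config,
  (forall v, k <= e v)%N &
  forall c, recurrent c -> stabilization (c + e) = c.
Proof.
pose K : config := [ffun v => k + outdeg (val v)]%N.
pose e : config := [ffun v => K v - stabilization K v]%N.
have sK v : (stabilization K v < outdeg (val v))%N.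
  by case: (stabilizationP K) => _ /forallP/(_ v); rewrite -ltnNge.
have eK : e + stabilization K = K.
  apply/ffunP=> v; rewrite configD !ffunE subnK //.
  exact: leq_trans (ltnW (sK v)) (leq_addl _ _).
exists e => [v|c [_ cP]].
  by rewrite !ffunE -addnBA ?leq_addr // ltnW.
have [b <-] := cP K.
rewrite addrC stabilizationDr -(stabilizationDr e) -(stabilizationDl K).
by rewrite stabilizationDr addrA eK stabilizationDl.
Qed.

Lemma recurrent_class_inj a b : recurrent a -> recurrent b ->
  config_class a = config_class b -> a = b.
Proof.
move=> ra rb /coker_pi_eq[x E].
pose p : config := [ffun v => `|Num.max (x v) 0|%N].
pose q : config := [ffun v => `|Num.max (- x v) 0|%N].
have xpq : x = int_config p - int_config q.
  by apply/ffunP=> v; rewrite !ffunE; lia.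
pose P := ((\sum_v p v + \sum_v q v) * \sum_(v : nonsink) outdeg (val v))%N.
have [e eM eP] :=
  exists_large (P + \sum_v `|laplacian (int_config q) v|)%N.
pose z := int_config (a + e) + laplacian (int_config q).
pose d : config := [ffun v => `|z v|%N].
have zP v : P%:Z <= z v.
  have le : (`|laplacian (int_config q) v|
              <= \sum_v `|laplacian (int_config q) v|)%N.
    by rewrite (bigD1 v) //= leq_addr.
  rewrite /z ffunE [int_config _ v]ffunE configD; have := eM v.
  by set A := laplacian _ _ in le *; lia.
have dP v : (P <= d v)%N by rewrite ffunE; have := zP v; lia.
have dE : int_config d = z.
  apply/ffunP=> v; rewrite 2!ffunE; move: (z v) (zP v) => y; lia.
have oP (v : nonsink) : (outdeg (val v) <= \sum_(w : nonsink) outdeg (val w))%N.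
  by rewrite (bigD1 v) //= leq_addr.
have da : steps d (a + e).
  apply: (fire_script (f := q)) => [v|]; last by rewrite dE /z addrK.
  apply: leq_trans (dP v); rewrite -big_distrl /=.
  by apply: leq_mul (oP v); apply: leq_addl.
have db : steps d (b + e).
  apply: (fire_script (f := p)) => [v|].
    apply: leq_trans (dP v); rewrite -big_distrl /=.
    by apply: leq_mul (oP v); apply: leq_addr.
  move: E; rewrite dE /z xpq raddfB /= !int_configD => E.
  have -> : int_config a = int_config b +
      (laplacian (int_config p) - laplacian (int_config q)).
    by rewrite -E addrC subrK.
  by rewrite [X in X + _ - _]addrAC -[X in X - _]addrA subrK addrK.
rewrite -(eP a ra) -(eP b rb) -(stabilization_steps da).
exact: stabilization_steps.
Qed.
End Laplacian.

Definition sandpile (Gam : sandpile_graph) :=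
  {c : config Gam | `[< recurrent c >]}.
HB.instance Definition _ Gam := SubChoice.on (sandpile Gam).

Section SandpileGroup.
Variable Gam : sandpile_graph.
Local Notation S := (sandpile Gam).
Implicit Types a b c : S.

Lemma sandpileP a : recurrent (val a).
Proof. by apply/asboolP; case: a. Qed.

Definition sandpile_class a : coker (@laplacian Gam) := config_class (val a).

Lemma sandpile_class_inj : injective sandpile_class.
Proof.
move=> a b ab; apply: val_inj.
by apply: recurrent_class_inj ab; apply: sandpileP.
Qed.

Lemma sandpile_class_surj q : exists a, sandpile_class a = q.
Proof.
have [x <-] := coker_piP q.
have [e eM eP] := @exists_large Gam
  (\sum_(v : nonsink Gam) (outdeg (val v) + `|x v|))%N.
pose b : config Gam :=
  [ffun v => `|(x v + (e v)%:Z - (outdeg (val v))%:Z)%R|%N].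
have bE : int_config (max_config Gam + b) = x + int_config e.
  apply/ffunP=> v; rewrite !ffunE; have := eM v; rewrite (bigD1 v) //=.
  set A := (\sum_(_ | _) _)%N; move: (x v) (e v) (outdeg _) A => y m t n; lia.
have rb := recurrent_max b.
exists (exist _ (stabilization (max_config Gam + b)) (asboolT rb)).
rewrite /sandpile_class /= config_class_stabilization {1}/config_class bE.
suff e0 : config_class e = 0 by rewrite raddfD /= [X in _ + X]e0 addr0.
apply: (addrI (config_class (stabilization (max_config Gam + b)))).
by rewrite addr0 -config_classD -config_class_stabilization eP.
Qed.

Definition sandpile_repr (q : coker (@laplacian Gam)) : S :=
  projT1 (cid (sandpile_class_surj q)).

Lemma sandpile_reprK : cancel sandpile_repr sandpile_class.
Proof. by move=> q; apply: (projT2 (cid (sandpile_class_surj q))). Qed.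

Lemma sandpile_classK : cancel sandpile_class sandpile_repr.
Proof. by move=> a; apply/sandpile_class_inj/sandpile_reprK. Qed.

Definition sandpile_add a b : S :=
  exist _ (stabilization (val a + val b))
        (asboolT (recurrentD (val b) (sandpileP a))).
Definition sandpile_zero : S := sandpile_repr 0.
Definition sandpile_opp a : S := sandpile_repr (- sandpile_class a).

Lemma sandpile_classD a b :
  sandpile_class (sandpile_add a b) = sandpile_class a + sandpile_class b.
Proof.
by rewrite /sandpile_class /= config_class_stabilization config_classD.
Qed.

Fact sandpile_addA : associative sandpile_add.
Proof.
by move=> a b c; apply: sandpile_class_inj; rewrite !sandpile_classD addrA.
Qed.
Fact sandpile_addC : commutative sandpile_add.
Proof.
by move=> a b; apply: sandpile_class_inj; rewrite !sandpile_classD addrC.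
Qed.
Fact sandpile_add0 : left_id sandpile_zero sandpile_add.
Proof.
move=> a; apply: sandpile_class_inj.
by rewrite sandpile_classD sandpile_reprK add0r.
Qed.
Fact sandpile_addN : left_inverse sandpile_zero sandpile_opp sandpile_add.
Proof.
move=> a; apply: sandpile_class_inj.
by rewrite sandpile_classD !sandpile_reprK addNr.
Qed.

HB.instance Definition _ := GRing.isZmodule.Build S
  sandpile_addA sandpile_addC sandpile_add0 sandpile_addN.

Lemma val_sandpileD a b : val (a + b) = stabilization (val a + val b).
Proof. by []. Qed.

Fact sandpile_class_is_zmod_morphism : zmod_morphism sandpile_class.
Proof.
move=> a b; apply: (addIr (sandpile_class b)).
by rewrite -sandpile_classD -[sandpile_add _ _]/(a - b + b) !subrK.
Qed.
HB.instance Definition _ :=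
  GRing.isZmodMorphism.Build S (coker (@laplacian Gam)) sandpile_class
    sandpile_class_is_zmod_morphism.

Lemma sandpile_class_bij : bijective sandpile_class.
Proof. exact: Bijective sandpile_classK sandpile_reprK. Qed.
End SandpileGroup.

(* MathComp actions are right actions: a left action [(g, v) |-> g v] is
   encoded by [gact v g = g^-1 v], which has the same orbits and the same
   invariants. *)
Record graph_action (gT : finGroupType) (Gam : sandpile_graph) := GraphAction {
  gact :> {action gT &-> vertex Gam};
  gact_sink : forall g, gact (sink Gam) g = sink Gam;
  gact_edge : forall g v w, edge v w ->
    edge (gact v g) (gact w g) /\ wt (gact v g) (gact w g) = wt v w }.

Section Symmetrized.
Variables (gT : finGroupType) (Gam : sandpile_graph) (to : graph_action gT Gam).
Local Notation nonsink := (nonsink Gam).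
Local Notation config := (config Gam).
Implicit Type g : gT.

Lemma gact_nonsink (v : nonsink) g : to (val v) g != sink Gam.
Proof.
by case: v => v vs /=; rewrite -(gact_sink to g) (inj_eq (act_inj to g)).
Qed.

Definition nsact (v : nonsink) g : nonsink :=
  Sub (to (val v) g) (gact_nonsink v g).

Fact nsact1 : nsact^~ 1%g =1 id.
Proof. by move=> v; apply: val_inj; rewrite /= act1. Qed.
Fact nsactM (v : nonsink) : act_morph nsact v.
Proof. by move=> g h; apply: val_inj; rewrite /= actM. Qed.
Definition nsaction : {action gT &-> nonsink} := TotalAction nsact1 nsactM.

Lemma gact_wt g v w : wt (to v g) (to w g) = wt v w.
Proof.
have [/(gact_edge to g)[]//|] := boolP (edge v w).
rewrite /edge -eqn0Ngt => /eqP vw; rewrite vw; apply/eqP.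
rewrite eqn0Ngt; apply/negP => /(gact_edge to g^-1%g)[]; rewrite !actK /edge.
by rewrite vw.
Qed.

Lemma gact_outdeg g v : outdeg (to v g) = outdeg v.
Proof.
rewrite /outdeg (reindex_inj (act_inj to g)) /=.
by apply: eq_bigr => w _; rewrite gact_wt.
Qed.

(* The linear extension of [v |-> nsaction v g] to configurations. *)
Definition config_act (c : config) g : config :=
  [ffun v => c (nsaction v g^-1%g)].

Lemma config_act0 g : config_act 0 g = 0.
Proof. by apply/ffunP=> v; rewrite !ffunE. Qed.

Lemma config_actD c d g :
  config_act (c + d) g = config_act c g + config_act d g.
Proof. by apply/ffunP=> v; rewrite !ffunE. Qed.

Lemma config_actK g : cancel (config_act^~ g) (config_act^~ g^-1%g).
Proof. by move=> c; apply/ffunP=> v; rewrite !ffunE invgK actK. Qed.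

Lemma config_act_fires g c d :
  fires c d -> fires (config_act c g) (config_act d g).
Proof.
case=> v cv ->; exists (nsaction v g).
  by rewrite /unstable ffunE actK gact_outdeg.
apply/ffunP=> w; rewrite !ffunE /= gact_outdeg.
congr (_ - _ + _)%N; last by rewrite -[LHS](gact_wt g) /= actKV.
rewrite (_ : (_ == v) = (w == nsaction v g)) //.
apply/eqP/eqP => [<-|->]; first by rewrite (actKV nsaction g).
exact: (actK nsaction g).
Qed.

Lemma config_act_stable g c : stable c -> stable (config_act c g).
Proof.
move/forallP=> cs; apply/forallP=> v; have := cs (nsaction v g^-1%g).
by rewrite /unstable ffunE /= gact_outdeg.
Qed.

Lemma config_act_stabilization g c :
  config_act (stabilization c) g = stabilization (config_act c g).
Proof.
have [st cs] := stabilizationP c; apply/esym/stabilizationE; split.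
  elim: st {cs} => [x|x y z xy _ IH]; first exact: rt1n_refl.
  exact: Relation_Operators.rt1n_trans (config_act_fires g xy) IH.
exact: config_act_stable.
Qed.

Definition sandpile_fixed : {pred sandpile Gam} :=
  [pred c | [forall g : gT, config_act (val c) g == val c]].

Lemma sandpile_fixedP (c : sandpile Gam) :
  reflect (forall g, config_act (val c) g = val c) (c \in sandpile_fixed).
Proof. exact: 'forall_eqP. Qed.

Fact sandpile_fixed_closed : zmod_closed sandpile_fixed.
Proof.
have ract (c : sandpile Gam) g : recurrent (config_act (val c) g).
  have [cs cP] := sandpileP c; split=> [|a]; first exact: config_act_stable.
  have [b ab] := cP (config_act a g^-1%g); exists (config_act b g).
  rewrite -ab config_act_stabilization config_actD.
  congr (stabilization (_ + _)).
  by rewrite -{2}(invgK g) config_actK.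
pose sact (c : sandpile Gam) g : sandpile Gam :=
  Sub (config_act (val c) g) (asboolT (ract c g)).
have sactD g : {morph sact^~ g : x y / x + y}.
  move=> x y; apply: val_inj.
  by rewrite val_sandpileD /= config_act_stabilization config_actD.
have sact0 g : sact 0 g = 0 by apply: (addIr (sact 0 g)); rewrite -sactD !add0r.
have fixE x : x \in sandpile_fixed <-> forall g, sact x g = x.
  split=> [/sandpile_fixedP xP g|xP]; first exact/val_inj/xP.
  by apply/sandpile_fixedP=> g; rewrite -[in RHS](xP g).
split=> [|x y /fixE xP /fixE yP]; apply/fixE=> // g.
by apply: (addIr (sact y g)); rewrite -sactD subrK xP yP subrK.
Qed.
HB.instance Definition _ :=
  GRing.isZmodClosed.Build (sandpile Gam) sandpile_fixed sandpile_fixed_closed.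

Definition sandpileG := {c : sandpile Gam | c \in sandpile_fixed}.
HB.instance Definition _ := SubChoice.on sandpileG.
HB.instance Definition _ := [SubChoice_isSubZmodule of sandpileG by <:].

Definition orbits :=
  {A : {set nonsink} | A \in orbit nsaction [set: gT] @: [set: nonsink]}.
HB.instance Definition _ := Finite.on orbits.

Definition orbit_of (v : nonsink) : orbits :=
  exist _ (orbit nsaction [set: gT] v) (imset_f _ (in_setT v)).

Lemma orbits_repr_ex (o : orbits) : exists v, orbit_of v == o.
Proof.
by have /imsetP[v _ ov] := valP o; exists v; apply/eqP/val_inj.
Qed.

Definition orbit_repr (o : orbits) : nonsink := xchoose (orbits_repr_ex o).

Lemma orbit_reprK : cancel orbit_repr orbit_of.
Proof. by move=> o; apply/eqP/(xchooseP (orbits_repr_ex o)). Qed.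

Definition sym_laplacian1 (o : orbits) : {ffun orbits -> int} :=
  [ffun o' => (\sum_(u in val o) laplacian (zvec u)) (orbit_repr o')].

Definition sym_laplacian (x : {ffun orbits -> int}) : {ffun orbits -> int} :=
  \sum_o sym_laplacian1 o *~ x o.

Fact sym_laplacian_is_zmod_morphism : zmod_morphism sym_laplacian.
Proof.
move=> x y; rewrite /sym_laplacian -sumrB; apply: eq_bigr => o _.
by rewrite !ffunE mulrzBr.
Qed.
HB.instance Definition _ :=
  GRing.isZmodMorphism.Build {ffun orbits -> int} {ffun orbits -> int}
    sym_laplacian sym_laplacian_is_zmod_morphism.

Lemma laplacian1_act g (v w : nonsink) :
  laplacian1 (nsaction v g) (nsaction w g) = laplacian1 v w.
Proof.
by rewrite !laplacian1E (inj_eq (act_inj nsaction g)) /= gact_outdeg gact_wt.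
Qed.

(* The defining property; the choice of representatives is immaterial. *)
Lemma sym_laplacianE (v w : nonsink) :
  sym_laplacian (zvec (orbit_of v)) (orbit_of w)
  = (\sum_(u in orbit nsaction [set: gT] v) laplacian (zvec u)) w.
Proof.
rewrite /sym_laplacian (bigD1 (orbit_of v)) //= big1 => [|o /negPf ov];
  last first.
  by rewrite zvecE ov mulr0z.
rewrite addr0 zvecE eqxx mulr1z ffunE /=.
have /(congr1 val)/= E := orbit_reprK (orbit_of w).
have : w \in orbit nsaction [set: gT] (orbit_repr (orbit_of w)).
  by rewrite E orbit_refl.
move: (orbit_repr _) => w'; case/orbitP=> g _ <- {E}.
rewrite !sum_ffunE [RHS](reindex_inj (act_inj nsaction g)) /=.
apply: eq_big => [u|u _]; last by rewrite !laplacian_zvec -(laplacian1_act g).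
by apply: esym; apply: (orbit_actr nsaction); rewrite inE.
Qed.

Definition orbit_sum (v : nonsink) : {ffun nonsink -> int} :=
  \sum_(w in orbit nsaction [set: gT] v) zvec w.
End Symmetrized.

(* Main.v *)
(* Functions on orbits embed as the G-invariant functions on non-sink vertices,
   and this embedding L intertwines the symmetrized Laplacian with the reduced
   Laplacian, so it descends to the cokernels.  The image of the descended map
   consists of invariant classes, whose recurrent representatives are invariant
   by uniqueness; conversely an invariant recurrent configuration is itself of
   the form L x.  For injectivity, if L x is the Laplacian of y, then y is
   invariant because the Laplacian is equivariant and injective, so y = L z and
   x is the symmetrized Laplacian of z. *)
Require Import Defs.
From HB Require Import structures.
From mathcomp Require Import all_boot all_order all_fingroup all_algebra.
From mathcomp Require Import boolp.

Set Implicit Arguments.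
Unset Strict Implicit.
Unset Printing Implicit Defensive.

Import GRing.Theory Num.Theory.
Local Open Scope ring_scope.

(** * Additive maps out of cokernels and out of integer functions *)

Lemma coker_factor (U V W : zmodType) (f : {additive U -> V})
    (g : {additive V -> W}) :
  (forall u, g (f u) = 0) ->
  exists h : {additive coker f -> W}, forall x, h (coker_pi f x) = g x.
Proof.
move=> gf0; pose h (q : coker f) := g (projT1 (cid (coker_piP q))).
have hE x : h (coker_pi f x) = g x.
  rewrite /h; case: cid => y /= /coker_pi_eq[u xy].
  by apply/eqP; rewrite -subr_eq0 -raddfB xy gf0.
have hB : zmod_morphism h.
  move=> p q; have [x <-] := coker_piP p; have [y <-] := coker_piP q.
  by rewrite -raddfB !hE raddfB.
pose hA := GRing.isZmodMorphism.Build _ _ h hB.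
by exists (HB.pack_for {additive coker f -> W} h hA).
Qed.

Lemma zvec_expand (I : finType) (x : {ffun I -> int}) :
  x = \sum_i zvec i *~ x i.
Proof.
apply/ffunP=> j; rewrite sum_ffunE (bigD1 j) //= big1 => [|i /negPf ij].
  by rewrite addr0 ffunMzE zvecE eqxx intz.
by rewrite ffunMzE zvecE eq_sym ij mul0rz.
Qed.

Lemma eq_additive_zvec (I : finType) (W : zmodType)
    (f g : {additive {ffun I -> int} -> W}) :
  (forall i, f (zvec i) = g (zvec i)) -> f =1 g.
Proof.
move=> fg x; rewrite [x]zvec_expand !raddf_sum; apply: eq_bigr => i _.
by rewrite !raddfMz fg.
Qed.

Lemma laplacianE (Gam : sandpile_graph) (x : {ffun nonsink Gam -> int}) w :
  laplacian x w = \sum_v laplacian1 v w *~ x v.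
Proof. by rewrite sum_ffunE; apply: eq_bigr => v _; rewrite ffunMzE. Qed.

(* If [laplacian x = 0], pairing |x| with a potential h that drops at every
   firing gives [\sum |x v| <= 0]. *)
Lemma laplacian_inj (Gam : sandpile_graph) : injective (@laplacian Gam).
Proof.
apply: raddf_inj => x x0.
have [h hP] := exists_potential Gam.
pose A v := `|x v|%N.
(* The [w]-component of [laplacian x = 0] expresses [outdeg w * x w] as a weighted sum of values of
   [x]; the triangle inequality then bounds it. *)
have le w : (A w * outdeg (val w) <= \sum_v A v * wt (val v) (val w))%N.
  have : (outdeg (val w))%:Z *~ x w
         = \sum_v (wt (val v) (val w))%:Z *~ x v.
    have /ffunP/(_ w) := x0; rewrite laplacianE [RHS]ffunE => xw.
    apply/subr0_eq; rewrite -[RHS]xw; apply/esym.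
    under eq_bigr => v _ do rewrite laplacian1E mulrzBl.
    rewrite sumrB (bigD1 w) //= eqxx big1 ?addr0 // => v.
    by rewrite eq_sym => /negPf->; rewrite mul0rz.
  move/(congr1 absz); rewrite -mulrzr intz abszM mulnC => ->.
  elim/big_ind2: _ => // [m a n b am bn|v _]; last first.
    by rewrite -mulrzr intz abszM mulnC.
  apply: leq_trans (leq_add am bn).
  by rewrite -lez_nat PoszD !abszE ler_normD.
(* The strict drop of [h] at [v] leaves one unit of slack, which becomes the extra [A v]. *)
have lt v : (A v * \sum_(w : nonsink Gam) wt (val v) (val w) * h (val w)
             + A v <= A v * (outdeg (val v) * h (val v)))%N.
  rewrite -mulnSr leq_mul2l; apply/orP; right; apply: leq_trans (hP _ (valP v)).
  by rewrite ltnS (sum_nonsink (fun w => wt (val v) w * h w)%N).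
have : (\sum_w A w * (outdeg (val w) * h (val w))
        <= \sum_v A v *
             \sum_(w : nonsink Gam) wt (val v) (val w) * h (val w))%N.
  under [leqRHS]eq_bigr => v _ do rewrite big_distrr /=.
  rewrite exchange_big /=; apply: leq_sum => w _.
  rewrite mulnA (leq_trans (leq_mul (le w) (leqnn _))) // big_distrl /=.
  by apply: leq_sum => v _; rewrite mulnA.
move/(leq_trans (leq_sum _ (fun v _ => lt v))).
rewrite big_split /= -[leqRHS]addn0 leq_add2l leqn0 sum_nat_eq0.
move/forallP=> A0; apply/ffunP=> v; rewrite ffunE; apply/eqP.
by rewrite -absz_eq0; exact: A0.
Qed.

(** Stabilization commutes with the action: recurrence of [c] is applied to [a] moved back by [g],
    and the resulting [b] is moved forward. *)
Lemma recurrent_act (gT : finGroupType) (Gam : sandpile_graph)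
    (to : graph_action gT Gam) (c : config Gam) g :
  recurrent c -> recurrent (config_act to c g).
Proof.
case=> cs cP; split=> [|a]; first exact: config_act_stable.
have [b ab] := cP (config_act to a g^-1%g); exists (config_act to b g).
rewrite -ab config_act_stabilization config_actD.
by have := config_actK to g^-1%g a; rewrite invgK => ->.
Qed.

(** * Functions on orbits as invariant functions on vertices *)

Section OrbitLift.
Variables (gT : finGroupType) (Gam : sandpile_graph).
Variable to : graph_action gT Gam.
Local Notation zconfig := {ffun nonsink Gam -> int}.
Local Notation zorbits := {ffun orbits to -> int}.

Lemma orbit_of_eq v w :
  (orbit_of to w == orbit_of to v) = (w \in orbit (nsaction to) [set: gT] v).
Proof. by rewrite -val_eqE /=; exact: (orbit_eq_mem (nsaction to)). Qed.

Lemma orbit_of_act v g : orbit_of to (nsaction to v g) = orbit_of to v.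
Proof. by apply/eqP; rewrite orbit_of_eq mem_orbit ?inE. Qed.

(** Pullback along [g], whereas [config_act] pulls back along the inverse of [g]; invariance under
    the whole group means the same for both. *)
Definition zconfig_act (g : gT) (x : zconfig) : zconfig :=
  [ffun v => x (nsaction to v g)].

Lemma int_config_act c g :
  int_config (config_act to c g) = zconfig_act g^-1%g (int_config c).
Proof. by apply/ffunP=> v; rewrite !ffunE. Qed.

Lemma laplacian_act g x :
  laplacian (zconfig_act g x) = zconfig_act g (laplacian x).
Proof.
apply/ffunP=> w; rewrite [RHS]ffunE !laplacianE.
rewrite [RHS](reindex_inj (act_inj (nsaction to) g)) /=.
apply: eq_bigr => v _.
by rewrite [zconfig_act g x v]ffunE -(laplacian1_act to g).
Qed.

Definition orbit_lift (x : zorbits) : zconfig := [ffun v => x (orbit_of to v)].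

Fact orbit_lift_is_zmod_morphism : zmod_morphism orbit_lift.
Proof. by move=> x y; apply/ffunP=> v; rewrite !ffunE. Qed.
HB.instance Definition _ := GRing.isZmodMorphism.Build zorbits zconfig
  orbit_lift orbit_lift_is_zmod_morphism.

Lemma orbit_lift_inj : injective orbit_lift.
Proof.
move=> x y /ffunP xy; apply/ffunP=> o.
by have := xy (orbit_repr o); rewrite !ffunE orbit_reprK.
Qed.

Lemma orbit_lift_zvec v : orbit_lift (zvec (orbit_of to v)) = orbit_sum to v.
Proof.
apply/ffunP=> w; rewrite 2!ffunE orbit_of_eq sum_ffunE.
under eq_bigr => u _ do rewrite zvecE.
have [wv|wv] := boolP (w \in _).
  rewrite (bigD1 w) //= eqxx big1 ?addr0 // => u /andP[_ /negPf].
  by rewrite eq_sym => ->.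
rewrite big1 // => u uv; case: eqP => // wu.
by rewrite wu uv in wv.
Qed.

Lemma orbit_lift_act g x : zconfig_act g (orbit_lift x) = orbit_lift x.
Proof. by apply/ffunP=> v; rewrite !ffunE orbit_of_act. Qed.

Lemma orbit_lift_surj y :
  (forall g, zconfig_act g y = y) -> exists x, y = orbit_lift x.
Proof.
move=> yP; exists [ffun o => y (orbit_repr o)]; apply/ffunP=> v; rewrite !ffunE.
have /eqP := orbit_reprK (orbit_of to v); rewrite orbit_of_eq.
by case/orbitP=> g _ <-; rewrite -{1}(yP g) ffunE.
Qed.

Lemma laplacian_orbit_lift x :
  laplacian (orbit_lift x) = orbit_lift (sym_laplacian x).
Proof.
(* Both sides are additive in [x]; on the basis vector of an orbit the claim is the defining
   property [sym_laplacianE]. *)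
apply: (eq_additive_zvec (f := @laplacian Gam \o orbit_lift)
                        (g := orbit_lift \o @sym_laplacian gT Gam to)) x => o.
rewrite -[o]orbit_reprK; move: (orbit_repr o) => v /=.
apply/ffunP=> w; rewrite orbit_lift_zvec [RHS]ffunE sym_laplacianE.
by rewrite raddf_sum.
Qed.

(** * The map from orbit functions to invariant recurrent configurations *)

Lemma sandpile_repr_fixed x :
  sandpile_repr (coker_pi (@laplacian Gam) (orbit_lift x))
    \in sandpile_fixed to.
Proof.
set c := sandpile_repr _; apply/sandpile_fixedP=> g.
(* A class has only one recurrent representative, so comparing the classes of [c] and its translate
   suffices. *)
apply: recurrent_class_inj; [exact/recurrent_act/sandpileP|exact: sandpileP|].
have cE : config_class (val c) = coker_pi (@laplacian Gam) (orbit_lift x).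
  exact: sandpile_reprK.
rewrite cE /config_class int_config_act; move/coker_pi_eq: cE => [u cu].
(* Moving [u] along with [c] works because [orbit_lift x] stays fixed. *)
apply/coker_pi_eq; exists (zconfig_act g^-1%g u).
rewrite /= laplacian_act -cu -[in LHS](orbit_lift_act g^-1%g).
by apply/ffunP=> v; rewrite !ffunE.
Qed.

Definition fixed_of_orbits (x : zorbits) : sandpileG to :=
  Sub (sandpile_repr (coker_pi (@laplacian Gam) (orbit_lift x)))
      (sandpile_repr_fixed x).

Lemma class_fixed_of_orbits x :
  sandpile_class (val (fixed_of_orbits x))
  = coker_pi (@laplacian Gam) (orbit_lift x).
Proof. by rewrite SubK sandpile_reprK. Qed.

Fact fixed_of_orbits_is_zmod_morphism : zmod_morphism fixed_of_orbits.
Proof.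
move=> x y; apply/val_inj/sandpile_class_inj.
by rewrite !raddfB /= !class_fixed_of_orbits !raddfB.
Qed.
HB.instance Definition _ := GRing.isZmodMorphism.Build zorbits (sandpileG to)
  fixed_of_orbits fixed_of_orbits_is_zmod_morphism.

(** One direction lets the map factor through the cokernel; the other makes the factored map
    injective. *)
Lemma fixed_of_orbits_eq0 x :
  fixed_of_orbits x = 0 <-> exists z, x = sym_laplacian z.
Proof.
split=> [x0|[z ->]]; last first.
  apply/val_inj/sandpile_class_inj; rewrite class_fixed_of_orbits !raddf0.
  rewrite -(raddf0 (coker_pi _)); apply/coker_pi_eq.
  by exists (orbit_lift z); rewrite subr0 /= laplacian_orbit_lift.
have /coker_pi_eq[y] : coker_pi (@laplacian Gam) (orbit_lift x) = coker_pi _ 0.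
  by rewrite -class_fixed_of_orbits x0 !raddf0.
rewrite subr0 => xy; have [g|z yz] := @orbit_lift_surj y.
  (* [y] and its translates share the Laplacian [orbit_lift x]. *)
  by apply: laplacian_inj; rewrite laplacian_act -xy orbit_lift_act.
by exists z; apply: orbit_lift_inj; rewrite xy yz /= laplacian_orbit_lift.
Qed.

Lemma fixed_of_orbits_surj c : exists x, fixed_of_orbits x = c.
Proof.
have /sandpile_fixedP cfix := valP c.
have [g|x cx] := @orbit_lift_surj (int_config (val (val c))).
  by rewrite -{1}(invgK g) -int_config_act cfix.
exists x; apply/val_inj/sandpile_class_inj.
by rewrite class_fixed_of_orbits -cx.
Qed.

(** The classes of the orbit vectors generate the cokernel; uniqueness of the isomorphism
    follows. *)
Lemma orbit_coker_ext (W : zmodType)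
    (f g : {additive coker (@sym_laplacian gT Gam to) -> W}) :
  (forall v, f (coker_pi (@sym_laplacian gT Gam to) (zvec (orbit_of to v)))
           = g (coker_pi (@sym_laplacian gT Gam to) (zvec (orbit_of to v)))) ->
  f =1 g.
Proof.
move=> fg q; have [x <-] := coker_piP q.
apply: (eq_additive_zvec (f := f \o coker_pi (@sym_laplacian gT Gam to))
                        (g := g \o coker_pi (@sym_laplacian gT Gam to))) x => o.
by rewrite /= -[o]orbit_reprK fg.
Qed.
End OrbitLift.

Theorem proposition2p10 (gT : finGroupType) (Gam : sandpile_graph)
    (to : graph_action gT Gam) :
  exists phi : {additive coker (@sym_laplacian gT Gam to) -> sandpileG to},
    [/\ bijective phi,
        forall v : nonsink Gam,
          val (phi (coker_pi (@sym_laplacian gT Gam to) (zvec (orbit_of to v))))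
          = sandpile_repr (coker_pi (@laplacian Gam) (orbit_sum to v))
      & forall psi : {additive coker (@sym_laplacian gT Gam to) ->
                               sandpileG to},
          (forall v : nonsink Gam,
             val (psi (coker_pi (@sym_laplacian gT Gam to)
                                (zvec (orbit_of to v))))
             = sandpile_repr (coker_pi (@laplacian Gam) (orbit_sum to v))) ->
          psi =1 phi].

Proof.
have [u|phi phiE] := @coker_factor _ _ _ (@sym_laplacian gT Gam to)
                       (@fixed_of_orbits gT Gam to).
  by apply/fixed_of_orbits_eq0; exists u.
exists phi; split=> [|v|psi psiE].
- have phi_inj : injective phi.
    apply: raddf_inj => q; have [x <-] := coker_piP q; rewrite phiE.
    move/fixed_of_orbits_eq0 => [z xz].
    rewrite -(raddf0 (coker_pi _)); apply/coker_pi_eq.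
    by exists z; rewrite subr0.
  have phi_surj c : exists q, phi q = c.
    have [x <-] := fixed_of_orbits_surj c.
    by exists (coker_pi (@sym_laplacian gT Gam to) x).
  pose inv c := projT1 (cid (phi_surj c)).
  have invK : cancel inv phi by move=> c; exact: (projT2 (cid (phi_surj c))).
  by exists inv => // q; apply: phi_inj; rewrite invK.
- by rewrite phiE SubK orbit_lift_zvec.
- apply: orbit_coker_ext => v; apply: val_inj.
  by rewrite psiE phiE SubK orbit_lift_zvec.
Qed.
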